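(* Let $p\geq5$ be prime, $2\leq b\leq p$, $1\leq c\leq p-1$, $s=b+c(p-1)$, $r=s+p^t(p-1)d$ with integers $t\geq2$, $d\geq1$, $p\nmid d$, and let $m$ be an integer with $1\leq m\leq c-1-\epsilon$. Let $A=(\alpha(i,l))_{1\leq i\leq m+1,\,0\leq l\leq m}$ (defined in the context). Suppose one of the following holds: (1) $b\geq c+1$ and $m\in[1,b-c]$; (2) $b\geq c$ and $m\in[1,\frac{b-1}{2}]\cap[b-c+1,c-1-\epsilon]$; (3) $2\leq b\leq c-1$ and $m\in\left([1,\frac{b-1}{2}]\cup[b,c-2]\right)\cap[1,p+b-c]$; (4) $2\leq b\leq 2c-3-p$ and $m\in[p+b-c+1,\frac{p+b-2}{2}]\cap[p+b-c+1,c-3]$. Then for every $1\leq i\leq m$ the linear system $AX\equiv e_i\pmod p$ has a solution $X\in\mathbb{Z}_p^{m+1}$, where $e_i$ is the $i$-th standard basis vector.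
   Context: Intervals denote sets of integers. Binomial convention: for $n\in\mathbb{Z}_{\geq0}$, $\binom nk=0$ if $k<0$ or $k>n$. $\epsilon$: $0$ if $2c-1\leq b\leq p$; $1$ if $2(c-1)-p\leq b\leq 2(c-1)$; $2$ if $2\leq b\leq 2(c-1)-(p+1)$. $\epsilon_1$: $0$ if $2m+1\leq b\leq p$; $1$ if $2m+1-(p-1)\leq b\leq 2m$; $2$ if $2\leq b\leq 2m-(p-1)$. $\beta(a,i)$ ($a\geq1$, $1\leq i\leq m+1$): $\beta(1,i)=\binom{m+1}{i}$, $\beta(a,i)=\sum_{l=1}^{a-1}(-1)^{l+1}\binom{m+1}{l}\beta(a-l,i)+(-1)^{a-1}\binom{m+1}{i+a-1}$ for $a\geq2$. For $0\leq l\leq p-1$, $1\leq i\leq m+1$: $\alpha_1(i,l)=(-1)^{i+1}\sum_{a=1}^{c-m-\epsilon_1}\binom{r-l}{b-m+(c-m-a)(p-1)}\beta(a,i)$, and $\alpha(i,l)=\alpha_1(i,l)+\binom{r-l}{b-m+(i+c-m-1)(p-1)}$ if $1\leq i\leq m$, $\alpha(m+1,l)=\alpha_1(m+1,l)$. *)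

(* Defs.v *)
From HB Require Import structures.
From mathcomp Require Import all_boot all_order all_algebra.
From mathcomp Require Import boolp.

Set Implicit Arguments.
Unset Strict Implicit.
Unset Printing Implicit Defensive.

Import Order.TTheory GRing.Theory Num.Theory.
Local Open Scope ring_scope.

(* The p-adic integers, as the inverse limit of the rings Z/p^(n+1).  This is
   meant for p >= 2 only: 'Z_q is Z/2 when q <= 1. *)

Definition Zp_red (p n : nat) (x : 'Z_(p ^ n.+2)) : 'Z_(p ^ n.+1) := inZp x.

Record padic (p : nat) := Padic {
  padic_proj :> forall n, 'Z_(p ^ n.+1);
  padicP : forall n, Zp_red (padic_proj n.+1) = padic_proj n }.

Section PadicRing.
Variable p : nat.
Implicit Types x y z : padic p.

Lemma dvdn_Zp_trunc_exp n : ((Zp_trunc (p ^ n.+1)).+2 %| (Zp_trunc (p ^ n.+2)).+2)%N.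
Proof.
case: p => [|[|q]]; rewrite ?exp0n ?exp1n //.
have gt1 k : (1 < q.+2 ^ k.+1)%N by apply: leq_ltn_trans (ltn_expl k.+1 _).
by rewrite !Zp_cast ?dvdn_exp2l.
Qed.

Lemma Zp_redD n (x y : 'Z_(p ^ n.+2)) : Zp_red (x + y) = Zp_red x + Zp_red y.
Proof. by apply: val_inj => /=; rewrite modn_dvdm ?dvdn_Zp_trunc_exp // modnDm. Qed.

Lemma Zp_redM n (x y : 'Z_(p ^ n.+2)) : Zp_red (x * y) = Zp_red x * Zp_red y.
Proof. by apply: val_inj => /=; rewrite modn_dvdm ?dvdn_Zp_trunc_exp // modnMm. Qed.

Lemma Zp_red0 n : Zp_red (0 : 'Z_(p ^ n.+2)) = 0.
Proof. by apply: val_inj; rewrite /= mod0n. Qed.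

Lemma Zp_red1 n : Zp_red (1 : 'Z_(p ^ n.+2)) = 1.
Proof. exact: val_inj. Qed.

Lemma Zp_redN n (x : 'Z_(p ^ n.+2)) : Zp_red (- x) = - Zp_red x.
Proof. by apply/eqP; rewrite -subr_eq0 opprK -Zp_redD addNr Zp_red0. Qed.

Lemma padic_ext x y : (forall n, x n = y n) -> x = y.
Proof.
case: x y => [x xP] [y yP] /= exy.
have {}exy : x = y by apply: functional_extensionality_dep.
by case: _ / exy yP => yP; congr Padic; apply: Prop_irrelevance.
Qed.

Definition padic0 : padic p := Padic (fun n => Zp_red0 n).
Definition padic1 : padic p := Padic (fun n => Zp_red1 n).

Definition padicN x : padic p.
Proof. by exists (fun n => - x n) => n; rewrite Zp_redN padicP. Defined.

Definition padicD x y : padic p.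
Proof. by exists (fun n => x n + y n) => n; rewrite Zp_redD !padicP. Defined.

Definition padicM x y : padic p.
Proof. by exists (fun n => x n * y n) => n; rewrite Zp_redM !padicP. Defined.

Lemma padicDA : associative padicD.
Proof. by move=> x y z; apply: padic_ext => n; apply: addrA. Qed.

Lemma padicDC : commutative padicD.
Proof. by move=> x y; apply: padic_ext => n; apply: addrC. Qed.

Lemma padicD0 : left_id padic0 padicD.
Proof. by move=> x; apply: padic_ext => n; apply: add0r. Qed.

Lemma padicDN : left_inverse padic0 padicN padicD.
Proof. by move=> x; apply: padic_ext => n; apply: addNr. Qed.

Lemma padicMA : associative padicM.
Proof. by move=> x y z; apply: padic_ext => n; apply: mulrA. Qed.

Lemma padicMC : commutative padicM.
Proof. by move=> x y; apply: padic_ext => n; apply: mulrC. Qed.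

Lemma padicM1 : left_id padic1 padicM.
Proof. by move=> x; apply: padic_ext => n; apply: mul1r. Qed.

Lemma padicMD : left_distributive padicM padicD.
Proof. by move=> x y z; apply: padic_ext => n; apply: mulrDl. Qed.

Lemma padic1_neq0 : padic1 <> padic0.
Proof. by move=> /(congr1 (fun x : padic p => val (x 0%N))). Qed.

End PadicRing.

HB.instance Definition _ (p : nat) := gen_eqMixin (padic p).
HB.instance Definition _ (p : nat) := gen_choiceMixin (padic p).
HB.instance Definition _ (p : nat) := GRing.isZmodule.Build (padic p)
  (@padicDA p) (@padicDC p) (@padicD0 p) (@padicDN p).

Lemma padic_oner_neq0 (p : nat) : padic1 p != 0.
Proof. exact/eqP/padic1_neq0. Qed.

HB.instance Definition _ (p : nat) :=
  GRing.Zmodule_isComNzRing.Build (padic p)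
    (@padicMA p) (@padicMC p) (@padicM1 p) (@padicMD p) (@padic_oner_neq0 p).

Definition padic_eqmod (p k l : nat) (U V : 'M[padic p]_(k, l)) : Prop :=
  exists W : 'M[padic p]_(k, l), U - V = p%:R *: W.

Definition binz (n : nat) (k : int) : int :=
  if k is Posz j then 'C(n, j)%:Z else 0.

(* The last branch is the range 2 <= b <= 2(c-1)-(p+1). *)
Definition eps (p b c : nat) : nat :=
  if 2 * c%:Z - 1 <= b%:Z then 0
  else if 2 * (c%:Z - 1) - p%:Z <= b%:Z then 1
  else 2.

(* The last branch is the range 2 <= b <= 2m-(p-1). *)
Definition eps1 (p b m : nat) : nat :=
  if 2 * m%:Z + 1 <= b%:Z then 0
  else if 2 * m%:Z + 1 - (p%:Z - 1) <= b%:Z then 1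
  else 2.

(* beta_rev m i a is [:: beta(a,i); ...; beta(1,i)]; see beta1 and betaS for
   the recursion that defines beta. *)
Fixpoint beta_rev (m i a : nat) : seq int :=
  if a is a'.+1 then
    let s := beta_rev m i a' in
    (\sum_(1 <= l < a) (-1) ^+ l.+1 * 'C(m.+1, l)%:Z * s`_l.-1
      + (-1) ^+ a' * 'C(m.+1, i + a')%:Z) :: s
  else [::].

Definition beta (m a i : nat) : int := head 0 (beta_rev m i a).

Lemma beta1 (m i : nat) : beta m 1 i = 'C(m.+1, i)%:Z.
Proof. by rewrite /beta /= big_geq // add0r expr0 mul1r addn0. Qed.

Lemma beta_rev_nth (m i a l : nat) :
  (l < a)%N -> (beta_rev m i a)`_l = beta m (a - l) i.
Proof.
elim: a l => // a IHa [|l] la; first by rewrite subn0.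
by rewrite subSS -IHa.
Qed.

Lemma betaS (m i a : nat) : (2 <= a)%N ->
  beta m a i =
    \sum_(1 <= l < a) (-1) ^+ l.+1 * 'C(m.+1, l)%:Z * beta m (a - l) i
    + (-1) ^+ a.-1 * 'C(m.+1, i + a - 1)%:Z.
Proof.
case: a => [//|a] _; rewrite {1}/beta /= addnS subn1; congr (_ + _).
apply: eq_big_nat => -[//|l] /andP[_ la].
by rewrite /= beta_rev_nth ?subSS.
Qed.

Definition alpha1 (p b c m r i l : nat) : int :=
  (-1) ^+ i.+1 *
  \sum_(1 <= a < (c - m - eps1 p b m).+1)
     binz (r - l) (b%:Z - m%:Z + (c%:Z - m%:Z - a%:Z) * (p%:Z - 1))
     * beta m a i.

Definition alpha (p b c m r i l : nat) : int :=
  alpha1 p b c m r i l +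
  (if (i <= m)%N then
     binz (r - l) (b%:Z - m%:Z + (i%:Z + c%:Z - m%:Z - 1) * (p%:Z - 1))
   else 0).

(* The row of index i : 'I_m.+1 is the (i+1)-st one. *)
Definition alpha_mx (p b c m r : nat) : 'M[int]_m.+1 :=
  \matrix_(i, l) alpha p b c m r i.+1 l.

(* Main.v *)
Require Import Defs.
From mathcomp Require Import all_boot all_order all_algebra.
From mathcomp Require Import ring zify.
Set Implicit Arguments.
Unset Strict Implicit.
Unset Printing Implicit Defensive.
Import Order.TTheory GRing.Theory Num.Theory.
Local Open Scope ring_scope.

(** When b <= 2m, first replace (b, c) by (b + p - 1, c - 1), which preserves s,
    so that b > 2m and eps1 = 0. Put n = a + m. Modulo p, (-1)^(i+1) beta(a, i) is the value at n of the
    polynomial P_i of degree at most m with P_i(n) = [n = m + 1 - i] for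
    0 <= n <= m, and C(r - l, k) = C(s - l, k) for the indices k that occur, so
    alpha(i, l) is the sum over 1 <= n <= c of C(s - l, s - m - n(p-1)) P_i(n).
    Adding the term n = 0 gives a functional Psi_l on the polynomials of degree
    at most m. As k = s - m - n(p-1) equals s - m + n modulo p, the falling
    factorials k^_e are a basis of these polynomials, and reduction of
    (1 + X)^N modulo X^p - X gives Psi_l(k^_e) = (s-l)^_e C(b-l-e, m-l).
    This matrix is invertible, so some combination X of the Psi_l is evaluation
    at n0 = m + 1 - i. Since Psi_l((s-k)^_m) = m! C(s-l, m-l) is m! times the
    coefficient of the term n = 0, and (s-k)^_m vanishes at n = 1, ..., m, the
    terms n = 0 cancel in X, which therefore solves the system. *)

(** * Binomial coefficients modulo p *)

Section BinomialsModP.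
Variables (F : fieldType) (p : nat).
Hypothesis charFp : p \in [pchar F].

Let p_pr : prime p := pcharf_prime charFp.

Lemma natf_neq0_lt (n : nat) : (0 < n < p)%N -> n%:R != 0 :> F.
Proof.
by move=> /andP[n0 np]; rewrite -(dvdn_pcharf charFp) gtnNdvd.
Qed.

Lemma natf_inj_lt (i j : nat) :
  (i < p)%N -> (j < p)%N -> i%:R = j%:R :> F -> i = j.
Proof.
wlog le_ij : i j / (i <= j)%N.
  by move=> IH ip jp e; case: (leqP i j) => [/IH|/ltnW/IH] -> //.
move=> ip jp /eqP; rewrite eq_sym -subr_eq0 -natrB // => e.
case: (posnP (j - i)) => [|ji]; first by lia.
by move: e; apply/contraTeq => _; apply: natf_neq0_lt; lia.
Qed.

Lemma factf_neq0 (n : nat) : (n < p)%N -> n`!%:R != 0 :> F.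
Proof.
elim: n => [|n IHn] np; first by rewrite oner_neq0.
by rewrite factS natrM mulf_neq0 ?(IHn (ltnW np)) ?(@natf_neq0_lt n.+1).
Qed.

Lemma natr_ffact (n e : nat) :
  (n ^_ e)%:R = \prod_(0 <= i < e) (n%:R - i%:R) :> F.
Proof.
elim: e => [|e IHe]; first by rewrite big_geq.
rewrite ffactnSr natrM IHe big_nat_recr //=.
case: (leqP e n) => en; first by rewrite natrB.
rewrite -IHe ffact_small // !mul0r //.
Qed.

(** In Vandermonde's sum a term with 0 < j < p^t vanishes: p^t divides j C(p^t q, j) but not j, so p
    divides the binomial. *)
Lemma natr_binD_pexp (t q n k : nat) : (k < p ^ t)%N ->
  'C(n + p ^ t * q, k)%:R = 'C(n, k)%:R :> F.
Proof.
move=> kt; rewrite addnC -binomial.Vandermonde big_ord_recl /= bin0 mul1n subn0.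
rewrite natrD natr_sum big1 ?addr0 // => j _.
apply/eqP; rewrite -(dvdn_pcharf charFp) dvdn_mulr //= /bump /= add1n.
have jk := ltn_ord j.
apply: contraLR kt => pC; rewrite -leqNgt.
have: (p ^ t %| j.+1 * 'C(p ^ t * q, j.+1))%N.
  by rewrite -mul_bin_diag -mulnA dvdn_mulr.
rewrite Gauss_dvdl ?coprimeXl ?prime_coprime // => /dvdn_leq ptj.
exact: leq_trans (ptj isT) jk.
Qed.

(** This is the coefficient of X^k in (1 + X)^n (1 + X^p). *)
Lemma natr_binD_p (n k : nat) :
  'C(n + p, k)%:R =
    'C(n, k)%:R + (if (p <= k)%N then 'C(n, k - p)%:R else 0) :> F.
Proof.
case: ifPn => [pk|]; last first.
  rewrite -ltnNge => kp; rewrite addr0.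
  by have := @natr_binD_pexp 1 1 n k; rewrite expn1 muln1; apply.
rewrite addnC -binomial.Vandermonde big_ord_recl /= bin0 mul1n subn0.
rewrite natrD natr_sum; congr (_ + _).
have p0 := prime_gt0 p_pr.
have p1k : (p.-1 < k)%N by lia.
rewrite (bigD1 (Ordinal p1k)) //= /bump /= add1n prednK // binn mul1n.
rewrite big1 ?addr0 // => j /eqP jp.
have {}jp : (j : nat) <> p.-1 by move=> e; apply: jp; apply: val_inj.
apply/eqP; rewrite -(dvdn_pcharf charFp) add1n.
case: (ltnP j.+1 p) => jp1; first by rewrite dvdn_mulr // prime_dvd_bin.
by rewrite bin_small //; lia.
Qed.

(* Coefficientwise form of [(1 + X)^(n + c(p-1)) = (1 + X)^n] modulo [X^p - X]. *)
Lemma sum_bin_progression (c n rho : nat) :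
  (0 < rho < p)%N -> (0 < n)%N -> (n < rho + p.-1)%N ->
  \sum_(j < c.+1) 'C(n + c * p.-1, rho + j * p.-1)%:R = 'C(n, rho)%:R :> F.
Proof.
move=> /andP[rho0 rhop] n0 np.
have p0 := prime_gt0 p_pr.
elim: c => [|c <-]; first by rewrite big_ord1 !mul0n !addn0.
(* Splitting off (1 + X)^p leaves two sums, shifted by one term against each other, which Pascal's
   rule recombines. *)
have -> : (n + c.+1 * p.-1 = (n + c * p.-1).-1 + p)%N by nia.
under eq_bigr do rewrite natr_binD_p.
rewrite big_split /= big_ord_recr /= (bin_small (_ : _ < rho + c.+1 * p.-1)%N);
  last by nia.
rewrite addr0.
rewrite [X in _ + X]big_ord_recl /= ifF ?add0r; last by nia.
rewrite -big_split /=; apply: eq_bigr => j _.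
rewrite /bump /= mulSn ifT; last by nia.
have -> : (rho + (p.-1 + j * p.-1) - p = (rho + j * p.-1).-1)%N by nia.
rewrite -natrD; congr _%:R.
have -> : (n + c * p.-1 = (n + c * p.-1).-1.+1)%N by nia.
have -> : (rho + j * p.-1 = (rho + j * p.-1).-1.+1)%N by nia.
by rewrite binS.
Qed.

End BinomialsModP.

(** * Finite differences, triangular bases and interpolation *)

Section Polynomials.
Variable F : fieldType.
Implicit Types P : {poly F}.

(** By Pascal's rule, a difference of order M + 1 of P is one of order M of P(X) - P(X - 1), whose
    degree is smaller. *)
Lemma diff_poly_eq0 (M : nat) P (x : F) : (size P <= M)%N ->
  \sum_(l < M.+1) (-1) ^+ l * 'C(M, l)%:R * P.[x - l%:R] = 0.
Proof.
elim: M P x => [|M IHM] P x.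
  by rewrite leqn0 size_poly_eq0 => /eqP->; rewrite big_ord1 horner0 mulr0.
move=> sP; set Q := P - (P \Po ('X - 1%:P)).
have sQ : (size Q <= M)%N.
  have sc : size (P \Po ('X - 1%:P)) = size P by rewrite size_comp_poly2 ?size_XsubC.
  apply/leq_sizeP => j; rewrite leq_eqVlt => /orP[/eqP <-|Mj].
    rewrite coefB; case: (ltngtP (size P) M.+1) sP => // [sP _|sP _].
      by rewrite !nth_default ?sc ?subr0.
    have -> : P`_M = lead_coef P by rewrite lead_coefE sP.
    have -> : (P \Po ('X - 1%:P))`_M = lead_coef (P \Po ('X - 1%:P)).
      by rewrite lead_coefE sc sP.
    by rewrite lead_coef_comp ?size_XsubC // lead_coefXsubC expr1n mulr1 subrr.
  by rewrite coefB !nth_default ?sc ?subr0 //; apply: leq_trans Mj.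
rewrite -[RHS](IHM Q x sQ) big_ord_recl /= bin0.
under eq_bigr do rewrite /bump /= add1n binS natrD mulrDr mulrDl.
rewrite big_split /= addrA big_ord_recr /= bin_small // mulr0 mul0r addr0.
rewrite /Q; under [RHS]eq_bigr do rewrite hornerD hornerN horner_comp mulrBr.
rewrite [RHS]sumrB; congr (_ + _).
  by rewrite [RHS]big_ord_recl /= bin0; congr (_ + _).
rewrite -sumrN; apply: eq_bigr => j _; rewrite exprS !hornerE.
by rewrite -(natr1 j) opprD addrA; ring.
Qed.

Lemma poly_triangular_ind (g : nat -> {poly F}) (T : {poly F} -> F) (M : nat) :
  (forall e, size (g e) = e.+1) ->
  (forall a P Q, T (a *: P + Q) = a * T P + T Q) ->
  (forall e, (e < M)%N -> T (g e) = 0) ->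
  forall P, (size P <= M)%N -> T P = 0.
Proof.
move=> sg Tlin Tg P.
(* Only the size bound becomes N; [Tg] keeps its range e < M. *)
have: (M <= M)%N by []; move: {1 3}M => N.
elim: N P => [|N IHN] P NM.
  rewrite leqn0 size_poly_eq0 => /eqP->.
  have := Tlin 1 0 0; rewrite scaler0 addr0 mul1r => /esym/eqP.
  by rewrite -subr_eq0 addrK => /eqP.
move=> sP; set a := P`_N / (g N)`_N.
have gN : (g N)`_N != 0.
  by have := lead_coef_eq0 (g N); rewrite lead_coefE sg -size_poly_eq0 sg => ->.
have -> : P = a *: g N + (P - a *: g N) by rewrite addrC subrK.
rewrite Tlin (Tg N NM) mulr0 add0r IHN //; first exact: ltnW.
apply/leq_sizeP => j; rewrite leq_eqVlt => /orP[/eqP <-|Nj].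
  by rewrite coefB coefZ /a divfK ?subrr.
by rewrite coefB coefZ !nth_default ?mulr0 ?subr0 ?sg // (leq_trans sP).
Qed.

Lemma lagrange_exists (M : nat) (x : nat -> F) (i : nat) :
  (forall j k, (j < M)%N -> (k < M)%N -> x j = x k -> j = k) -> (i < M)%N ->
  exists2 P : {poly F}, (size P <= M)%N &
    forall j, (j < M)%N -> P.[x j] = (j == i)%:R.
Proof.
move=> xinj iM.
pose D := \prod_(j in predC1 (Ordinal iM)) ('X - (x j)%:P).
have D0 : D.[x i] != 0.
  rewrite horner_prod; apply/prodf_neq0 => j ji; rewrite hornerXsubC subr_eq0.
  by apply: contraNneq ji => e; apply/eqP/val_inj/xinj; rewrite ?e ?ltn_ord.
exists (D.[x i]^-1 *: D).
  rewrite (leq_trans (size_scale_leq _ _)) //.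
  rewrite /D -big_enum size_prod_XsubC -cardE cardC1 card_ord.
  by rewrite prednK // (leq_trans _ iM).
move=> j jM; rewrite hornerZ; case: eqVneq => [->|ji]; first by rewrite mulVf.
rewrite [D.[x j]]horner_prod (bigD1 (Ordinal jM)) //=.
by rewrite hornerXsubC subrr mul0r mulr0.
Qed.

End Polynomials.

(** * Products of binomial coefficients *)

Lemma mul_bin_ffact (n k e : nat) : (e <= k)%N ->
  ('C(n, k) * k ^_ e = n ^_ e * 'C(n - e, k - e))%N.
Proof.
elim: e => [|e IHe] ek; first by rewrite !ffactn0 muln1 mul1n !subn0.
rewrite !ffactnSr mulnA IHe ?(ltnW ek) // -!mulnA; congr (_ * _)%N.
have := mul_bin_diag (n - e) (k - e.+1).
by rewrite -subnS -subSn // subSS => ->; rewrite mulnC.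
Qed.

(** Both sides count the pairs of disjoint subsets of sizes k and t. *)
Lemma mul_bin_sub (n k t : nat) :
  ('C(n, k) * 'C(n - k, t) = 'C(n, t) * 'C(n - t, k))%N.
Proof.
have [kn|kn] := leqP (k + t) n; last first.
  have zero u v : (n < u + v)%N -> ('C(n, u) * 'C(n - u, v) = 0)%N.
    move=> uv; case: (leqP u n) => un; last by rewrite bin_small.
    by rewrite (bin_small (_ : n - u < v)%N) ?muln0 //; lia.
  by rewrite !zero // addnC.
apply/eqP; rewrite -(eqn_pmul2r (fact_gt0 k)) -(eqn_pmul2r (fact_gt0 t)).
rewrite -(eqn_pmul2r (fact_gt0 (n - k - t))); apply/eqP.
have ek := @bin_fact n k ltac:(lia); have et := @bin_fact n t ltac:(lia).
have ekt := @bin_fact (n - k) t ltac:(lia).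
have etk := @bin_fact (n - t) k ltac:(lia).
transitivity n`!; first by rewrite -ek -ekt; ring.
by rewrite -et -etk (_ : n - t - k = n - k - t)%N; [ring | lia].
Qed.

(** * The moment system, for parameters with 2m < b *)

Section Core.
Variables (F : fieldType) (p : nat).
Hypothesis charFp : p \in [pchar F].
Variables b c m : nat.
Hypotheses (m2b : (2 * m < b)%N) (bmp : (b - m < p)%N).
Hypotheses (mc : (m < c)%N) (cp : (c < p)%N).

Local Notation s := (b + c * p.-1)%N.

Let p1E : p.-1%:R = -1 :> F.
Proof.
apply/eqP; rewrite -subr_eq0 opprK natr1 prednK ?(pcharf0 charFp) //.
exact: leq_ltn_trans cp.
Qed.

Let sE : s%:R = b%:R - c%:R :> F.
Proof. by rewrite natrD natrM p1E mulrN1. Qed.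

(* Up to nonzero row and column factors, the entries are the values at
   [x = b - l] of polynomials [G e] of degree [m], which are linearly independent
   because evaluation at the points [x = e - 1] is triangular on them. *)
Lemma bin_mx_unit :
  \matrix_(e < m.+1, l < m.+1) ((s - l) ^_ e * 'C(b - l - e, m - l))%:R
    \in @unitmx F m.+1.
Proof.
rewrite -row_free_unit; apply: inj_row_free => v /rowP v0.
(* Dividing by the row factor in [hG] makes T(b - l) a multiple of entry l of v times the matrix,
   hence zero. *)
pose a e := v 0 e / (b - m - e)`!%:R.
pose G (e : nat) : {poly F} := (\prod_(0 <= i < e) ('X - (c + i)%:R%:P)) *
  \prod_(e <= i < m) ('X - i%:R%:P).
pose T := \sum_(e < m.+1) a e *: G e.
have factb (e : 'I_m.+1) : (b - m - e)`!%:R != 0 :> F.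
  by apply: (factf_neq0 charFp); lia.
have hG (e l : 'I_m.+1) : (G e).[(b - l)%:R] * (b - l - m)`!%:R =
    (b - m - e)`!%:R * (m - l)`!%:R *
    ((s - l) ^_ e * 'C(b - l - e, m - l))%:R.
  have lem := ltn_ord e; have llm := ltn_ord l.
  rewrite hornerM !horner_prod.
  have -> : \prod_(0 <= i < e) ('X - (c + i)%:R%:P).[(b - l)%:R] =
            ((s - l) ^_ e)%:R :> F.
    rewrite natr_ffact; apply: eq_bigr => i _.
    have [lb ls] : (l <= b /\ l <= s)%N by nia.
    by rewrite hornerXsubC (natrB _ lb) (natrB _ ls) sE natrD; ring.
  have -> : \prod_(e <= i < m) ('X - i%:R%:P).[(b - l)%:R] =
            ((b - l - e) ^_ (m - e))%:R :> F.
    rewrite natr_ffact -{1}(add0n (e : nat)) big_addn; apply: eq_bigr => i _.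
    have [lb el] : (l <= b /\ e <= b - l)%N by lia.
    by rewrite hornerXsubC (natrB _ el) natrD; ring.
  rewrite -!natrM; congr _%:R.
  have e1 := @ffact_fact (b - l - e) (m - e) ltac:(lia).
  have e2 := @bin_fact (b - l - e) (m - l) ltac:(lia).
  have e3 : (b - l - e - (m - e) = b - l - m)%N by lia.
  have e4 : (b - l - e - (m - l) = b - m - e)%N by lia.
  rewrite e3 in e1; rewrite e4 in e2.
  by rewrite -mulnA e1 -e2; ring.
have T_eq0 : T = 0.
  apply: (@roots_geq_poly_eq0 _ _ [seq (b - l)%:R | l <- iota 0 m.+1]).
  - apply/allP => _ /mapP[l + ->]; rewrite mem_iota add0n => /= lm.
    have blm : (b - l - m)`!%:R != 0 :> F by apply: (factf_neq0 charFp); lia.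
    rewrite /root -(mulIr_eq0 _ (mulIf blm)) /T horner_sum mulr_suml.
    have := v0 (Ordinal lm); rewrite !mxE => v0l.
    apply/eqP; rewrite -[RHS](mulr0 (m - l)`!%:R) -[X in _ = _ * X]v0l mulr_sumr.
    apply: eq_bigr => e _; rewrite hornerZ -mulrA (hG e (Ordinal lm)) mxE /=.
    by rewrite /a !mulrA divfK // [_ * v 0 e]mulrC.
  - rewrite map_inj_in_uniq ?iota_uniq // => l l'.
    rewrite !mem_iota !add0n => /= lm lm'.
    have -> : (b - l = b - m + (m - l))%N by lia.
    have -> : (b - l' = b - m + (m - l'))%N by lia.
    rewrite !natrD => /addrI/(natf_inj_lt charFp) e.
    have {}e : (m - l = m - l')%N by apply: e; lia.
    by lia.
  rewrite size_map size_iota; apply: (leq_trans (size_sum _ _ _)).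
  apply/bigmax_leqP => e _; apply: (leq_trans (size_scale_leq _ _)).
  apply: (leq_trans (size_mul_leq _ _)).
  by rewrite !size_prod_XsubC !size_iota; have := ltn_ord e; lia.
(* Downward induction on e. At the point e - 1 the terms e' > e vanish by induction and those with
   e' < e because [G e'] has this root, while [G e] is nonzero there. *)
have a0 : forall k (e : 'I_m.+1), (m - e)%N = k -> a e = 0.
  elim/ltn_ind => k IHk e ek.
  have := congr1 (fun P => P.[e%:R - 1]) T_eq0.
  rewrite horner0 /T horner_sum (bigD1 e) //= big1 ?addr0 => [|e' e'e]; last first.
    rewrite hornerZ; case: (ltngtP e' e) => [lt|gt|/val_inj eq]; last first.
    - by rewrite eq eqxx in e'e.
    - have lt' := ltn_ord e'.
      by rewrite (IHk (m - e')%N _ e') ?mul0r //; lia.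
    have lte := ltn_ord e; rewrite hornerM !horner_prod.
    suff -> : \prod_(e' <= i < m) ('X - i%:R%:P).[e%:R - 1] = 0 :> F.
      by rewrite !mulr0.
    apply/eqP; rewrite prodf_seq_eq0; apply/hasP; exists e.-1.
      by rewrite mem_index_iota; lia.
    rewrite /= hornerXsubC -subn1 natrB ?subrr //; lia.
  rewrite hornerZ => /eqP; rewrite mulf_eq0 => /orP[/eqP //|].
  have lte := ltn_ord e.
  rewrite hornerM !horner_prod mulf_eq0 !prodf_seq_eq0 => /orP[] /hasP[i];
    rewrite mem_index_iota hornerXsubC => /andP[i1 i2] /= => zero.
  - have : (c + i + 1 - e)%:R != 0 :> F by apply: (natf_neq0_lt charFp); lia.
    rewrite natrB; last by lia.
    rewrite -oppr_eq0 => /negP[]; rewrite -(eqP zero) !natrD.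
    by apply/eqP; ring.
  - have : (i + 1 - e)%:R != 0 :> F by apply: (natf_neq0_lt charFp); lia.
  rewrite natrB; last by lia.
    rewrite -oppr_eq0 => /negP[]; rewrite -(eqP zero) !natrD.
    by apply/eqP; ring.
apply/rowP => e; rewrite mxE.
by apply: (mulIf (invr_neq0 (factb e))); rewrite mul0r; apply: a0.
Qed.
(* [n] stands for [k = s - m - n(p-1)], which is [s - m + n] in [F]; at this node
   [node_ffact e] takes the value [k ^_ e], and [node_codeg] the value
   [(s - k) ^_ m] up to sign. *)
Definition full_moment (l : nat) (P : {poly F}) : F :=
  \sum_(n < c.+1) 'C(s - l, s - m - n * p.-1)%:R * P.[n%:R].

Definition node_ffact (e : nat) : {poly F} :=
  \prod_(0 <= i < e) ('X - (i%:R - (s - m)%:R)%:P).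

Definition node_codeg : {poly F} := \prod_(0 <= i < m) ('X - (m - i)%:R%:P).

(** Reversing the sum sets n = c - j, which [rev_ord] writes as [c.+1 - j.+1]. *)
Let s_sub_m (j : 'I_c.+1) :
  (s - m - (c.+1 - j.+1) * p.-1 = b - m + j * p.-1)%N.
Proof.
have jc : (j <= c)%N by rewrite -ltnS.
move: (leq_mul jc (leqnn p.-1)); rewrite subSS mulnBl.
by move: (c * _)%N (j * _)%N => x y; lia.
Qed.

(** Since C(s-l, k) k^_e = (s-l)^_e C(s-l-e, k-e), the sum runs over an arithmetic progression and
    reduces to C(b-l-e, b-m-e). *)
Lemma full_moment_ffact (l e : nat) : (l <= m)%N -> (e <= m)%N ->
  full_moment l (node_ffact e) = ((s - l) ^_ e * 'C(b - l - e, m - l))%:R.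
Proof.
move=> lm em; rewrite /full_moment (reindex_inj rev_ord_inj) /=.
have m1p : (m.+1 < p)%N by exact: leq_trans cp.
rewrite (eq_bigr (fun j : 'I_c.+1 => ((s - l) ^_ e)%:R *
    'C(b - l - e + c * p.-1, b - m - e + j * p.-1)%:R)) => [|j _].
  rewrite -mulr_sumr (sum_bin_progression charFp); try lia.
  rewrite -natrM; congr (_ * _)%:R.
  by rewrite -bin_sub; [congr 'C(_, _); lia | lia].
have -> : (node_ffact e).[(c.+1 - j.+1)%:R] = ((b - m + j * p.-1) ^_ e)%:R.
  rewrite natr_ffact horner_prod; apply: eq_bigr => i _.
  rewrite hornerXsubC -s_sub_m [in RHS]natrB; last first.
    by apply: ltnW; rewrite -subn_gt0 s_sub_m addn_gt0; apply/orP; left; lia.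
  by rewrite natrM p1E; ring.
rewrite s_sub_m -!natrM mul_bin_ffact; last by apply: leq_trans (leq_addr _ _); lia.
by congr (_ * 'C(_, _))%:R; nia.
Qed.

(** Vandermonde for s - k = l + (s-l-k) splits C(s-k, m) over i. Summing over the progression gives
    the factor C(l, i) C(b-l-(m-i), b-m), which is nonzero only for i = l. *)
Lemma full_moment_codeg (l : nat) : (l <= m)%N ->
  full_moment l node_codeg = (-1) ^+ m * m`!%:R * 'C(s - l, m - l)%:R.
Proof.
move=> lm; rewrite /full_moment (reindex_inj rev_ord_inj) /=.
have m1p : (m.+1 < p)%N by exact: leq_trans cp.
have ls : (l <= s)%N by nia.
rewrite (eq_bigr (fun j : 'I_c.+1 => (-1) ^+ m * m`!%:R *
   \sum_(i < m.+1) ('C(l, i) * 'C(s - l, m - i))%:R *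
     'C(b - l - (m - i) + c * p.-1, b - m + j * p.-1)%:R)) => [|j _].
  rewrite -mulr_sumr exchange_big /=; congr (_ * _).
  have lm1 : (l < m.+1)%N by [].
  rewrite (bigD1 (Ordinal lm1)) //= -mulr_sumr (sum_bin_progression charFp); try lia.
  rewrite binn mul1n (_ : b - l - (m - l) = b - m)%N; last by lia.
  rewrite binn mulr1 big1 ?addr0 // => i il.
  have {}il : (i : nat) <> l by move=> e; case/eqP: il; apply: val_inj.
  have im := ltn_ord i.
  rewrite -mulr_sumr (sum_bin_progression charFp); try lia.
  case: (ltngtP i l) => // li; first by rewrite [X in _ * X%:R]bin_small ?mulr0 //; lia.
  by rewrite [X in (X * _)%:R]bin_small ?mul0n ?mul0r.
have jc : (j <= c)%N by rewrite -ltnS.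
have Hk := s_sub_m j; rewrite Hk; set k := (b - m + j * p.-1)%N.
have sk : (s - k = m + (c - j) * p.-1)%N.
  move: (leq_mul jc (leqnn p.-1)); rewrite /k mulnBl.
  by move: (c * _)%N (j * _)%N => x y; lia.
have -> : node_codeg.[(c.+1 - j.+1)%:R] = (-1) ^+ m * m`!%:R * 'C(s - k, m)%:R.
  rewrite -mulrA -natrM mulnC bin_ffact natr_ffact horner_prod.
  rewrite -[in (-1) ^+ m](subn0 m) -prodr_const_nat -big_split /=.
  apply: eq_big_nat => i /andP[_ im].
  by rewrite hornerXsubC sk natrD natrM p1E subSS (natrB _ (ltnW im)); ring.
rewrite mulrCA; congr (_ * _); rewrite -natrM.
have -> : ('C(s - l, k) * 'C(s - k, m) = \sum_(i < m.+1)
    'C(l, i) * 'C(s - l, m - i) * 'C(b - l - (m - i) + c * p.-1, k))%N.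
  have [kl|kl] := leqP k (s - l).
    have -> : (s - k = l + (s - l - k))%N by lia.
    rewrite -binomial.Vandermonde big_distrr; apply: eq_bigr => i _ /=.
    rewrite mulnCA mul_bin_sub mulnA; congr (_ * 'C(_, _))%N.
    by have := ltn_ord i; move: (c * p.-1)%N => x; lia.
  rewrite bin_small // mul0n big1 // => i _.
  by rewrite [X in (_ * X)%N]bin_small ?muln0 //; have := ltn_ord i; nia.
by rewrite natr_sum; apply: eq_bigr => i _; rewrite -natrM.
Qed.

(* The moments without their [n = 0] term separate the nodes [1, ..., m]: the
   omitted term is proportional to the moment of [node_codeg], which vanishes
   at these nodes. *)
Lemma node_evaluation_moments (n0 : nat) : (0 < n0 <= m)%N ->
  exists X : 'cV[F]_m.+1, forall P : {poly F}, (size P <= m.+1)%N ->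
    \sum_(l < m.+1) X l 0 *
      (\sum_(1 <= n < c.+1) 'C(s - l, s - m - n * p.-1)%:R * P.[n%:R])
    = P.[n0%:R].
Proof.
move=> /andP[n0gt0 n0m].
pose M : 'M[F]_m.+1 := \matrix_(e, l) full_moment l (node_ffact e).
have ME : M = \matrix_(e < m.+1, l < m.+1)
    ((s - l) ^_ e * 'C(b - l - e, m - l))%:R.
  by apply/matrixP => e l; rewrite !mxE full_moment_ffact // -ltnS.
have Mu : M \in unitmx by rewrite ME bin_mx_unit.
pose X := invmx M *m (\col_e (node_ffact e).[n0%:R]); exists X.
have XE : forall P : {poly F}, (size P <= m.+1)%N ->
    \sum_(l < m.+1) X l 0 * full_moment l P = P.[n0%:R].
  move=> P sP; apply/eqP; rewrite -subr_eq0; apply/eqP; move: P sP.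
  apply: (poly_triangular_ind (g := node_ffact)) => [e|a P Q|e em].
  - by rewrite size_prod_XsubC size_iota subn0.
  - rewrite hornerD hornerZ.
    suff -> : \sum_(l < m.+1) X l 0 * full_moment l (a *: P + Q) =
        a * (\sum_(l < m.+1) X l 0 * full_moment l P) +
        \sum_(l < m.+1) X l 0 * full_moment l Q by ring.
    rewrite mulr_sumr -big_split /=.
    apply: eq_bigr => l _; rewrite mulrCA -mulrDr; congr (_ * _).
    rewrite mulr_sumr -big_split /=; apply: eq_bigr => n _.
    by rewrite hornerD hornerZ mulrDr mulrCA.
  - have /matrixP/(_ (Ordinal em) 0) : M *m X = \col_e (node_ffact e).[n0%:R].
      by rewrite mulKVmx.
    rewrite !mxE => /= <-; apply/eqP; rewrite subr_eq0; apply/eqP.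
    by apply: eq_bigr => l _; rewrite !mxE mulrC.
(* Apply [XE] to [node_codeg], which vanishes at n0, and cancel the unit m!. *)
have X0 : \sum_(l < m.+1) X l 0 * 'C(s - l, m - l)%:R = 0.
  have := XE node_codeg; rewrite size_prod_XsubC size_iota subn0 => /(_ (leqnn _)).
  have -> : node_codeg.[n0%:R] = 0.
    apply/eqP; rewrite horner_prod prodf_seq_eq0; apply/hasP; exists (m - n0)%N.
      by rewrite mem_index_iota; lia.
    by rewrite /= hornerXsubC subKn // subrr.
  under eq_bigr => l _ do rewrite full_moment_codeg -1?ltnS // mulrCA.
  rewrite -mulr_sumr => /eqP; rewrite mulf_eq0 mulf_eq0 signr_eq0 /=.
  have /negPf -> /= := factf_neq0 charFp (ltn_trans mc cp).
  by move=> /eqP.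
move=> P sP; rewrite -XE //.
apply/eqP; rewrite -subr_eq0 -oppr_eq0 opprB -sumrB; apply/eqP.
transitivity ((\sum_(l < m.+1) X l 0 * 'C(s - l, m - l)%:R) * P.[0]); last first.
  by rewrite X0 mul0r.
rewrite mulr_suml; apply: eq_bigr => l _.
rewrite -mulrBr -mulrA; congr (_ * _); rewrite /full_moment big_ord_recl /=.
rewrite big_add1 big_mkord addrK mul0n subn0; congr (_%:R * _).
by rewrite -bin_sub; [congr 'C(_, _) | ]; have := ltn_ord l; lia.
Qed.

End Core.

(** * [beta] as polynomial values and [alpha] as moments *)

Lemma beta_rec (m i a : nat) : (0 < a)%N ->
  beta m a i =
    \sum_(1 <= l < a) (-1) ^+ l.+1 * 'C(m.+1, l)%:Z * beta m (a - l) i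
    + (-1) ^+ a.-1 * 'C(m.+1, i + a - 1)%:Z.
Proof.
case: a => [//|[|a]] _; last exact: betaS.
by rewrite beta1 big_geq // add0r expr0 mul1r addn1 subn1.
Qed.

(* The recursion for [beta] says that the [m.+1]-st differences of the sequence
   extending [(-1)^(i+1) beta(a, i)] by a Kronecker delta at the [m.+1] places
   before [a = 1] vanish, as they do for a polynomial of degree at most [m]. *)
Lemma beta_lagrange (F : fieldType) (m i : nat) (P : {poly F}) :
  (0 < i <= m.+1)%N -> (size P <= m.+1)%N ->
  (forall n, (n <= m)%N -> P.[n%:R] = (n == m.+1 - i)%N%:R) ->
  forall a, (0 < a)%N -> (-1) ^+ i.+1 * (beta m a i)%:~R = P.[(m + a)%:R].
Proof.
move=> /andP[i0 im] sP Pn; elim/ltn_ind => a IHa a0.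
pose f l : F := (-1) ^+ l * 'C(m.+1, l)%:R * P.[(m + a)%:R - l%:R].
have := diff_poly_eq0 (m + a)%:R sP; rewrite -(big_mkord xpredT f).
(* With zero terms added, the nodes m + a - l descend to 0. *)
have -> : \sum_(0 <= l < m.+2) f l = \sum_(0 <= l < m + a.+1) f l.
  rewrite [RHS](@big_cat_nat _ _ _ m.+2) //=; last by lia.
  rewrite [X in _ + X]big1_seq ?addr0 // => l.
  rewrite mem_index_iota => /andP[_ /andP[ml _]].
  by rewrite /f bin_small // mulr0 mul0r.
rewrite (@big_cat_nat _ _ _ a) //=; last by lia.
rewrite [X in X + _]big_ltn // {1}/f expr0 bin0 !mul1r subr0.
(* These nodes lie in [0, m], where P is a Kronecker delta; only l = i + a - 1 hits m + 1 - i. *)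
have -> : \sum_(a <= l < m + a.+1) f l = (-1) ^+ (i + a - 1) * 'C(m.+1, i + a - 1)%:R.
  rewrite (bigD1_seq (i + a - 1)%N) ?iota_uniq //=; last first.
    by rewrite mem_index_iota; lia.
  rewrite {1}/f -natrB ?Pn; try lia.
  rewrite (_ : _ == _) ?mulr1; last by apply/eqP; lia.
  rewrite big1_seq ?addr0 // => l.
  rewrite mem_index_iota => /andP[li /andP[al lm]].
  rewrite /f -natrB ?Pn; try lia.
  by rewrite (_ : _ == _ = false) ?mulr0 //; apply/eqP => e; case/eqP: li; lia.
have -> : \sum_(1 <= l < a) f l = - \sum_(1 <= l < a)
    ((-1) ^+ i.+1 * ((-1) ^+ l.+1 * 'C(m.+1, l)%:Z * beta m (a - l) i)%:~R).
  rewrite -sumrN; apply: eq_big_nat => l /andP[l0 la].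
  have lma : (l <= m + a)%N by lia.
  rewrite /f -(natrB _ lma) -addnBA; last exact: ltnW.
  rewrite -IHa ?subn_gt0 ?ltn_subrL ?l0 //.
  by rewrite !rmorphM rmorphXn /= rmorphN1 (exprS _ l) -pmulrn; ring.
move=> /eqP; rewrite -addrA addr_eq0 opprD opprK => /eqP->.
rewrite (beta_rec _ _ a0) rmorphD /= rmorph_sum /= mulrDr mulr_sumr.
congr (_ + _); rewrite rmorphM rmorphXn /= rmorphN1.
by rewrite -addnBA // subn1 exprD exprS -pmulrn; ring.
Qed.

(** The terms n = m + a form [alpha1]. Among n = 1, ..., m only n = m + 1 - i contributes, giving
    the extra binomial; for i = m + 1 it would be n = 0, outside the sum. *)
Lemma alpha_moment (F : fieldType) (p b c m r i l e : nat) (P : {poly F}) :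
  (0 < p)%N -> (e <= c)%N ->
  let b' := (b + e * p.-1)%N in let c' := (c - e)%N in
  let s := (b' + c' * p.-1)%N in
  (m <= b')%N -> (m < c')%N -> eps1 p b m = e ->
  (forall k, (k <= s)%N -> 'C(r - l, k)%:R = 'C(s - l, k)%:R :> F) ->
  (0 < i <= m.+1)%N -> (size P <= m.+1)%N ->
  (forall n, (n <= m)%N -> P.[n%:R] = (n == m.+1 - i)%N%:R) ->
  (alpha p b c m r i l)%:~R =
    \sum_(1 <= n < c'.+1) 'C(s - l, s - m - n * p.-1)%:R * P.[n%:R].
Proof.
move=> p0 ec b' c' s mb mc eE binE ilim sP Pn.
have [i0 im] := andP ilim.
(* For n <= c' the integer index is nonnegative, so the truncated subtractions are exact. *)
have idx (n : nat) : (n <= c')%N ->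
    b%:Z - m%:Z + (c%:Z - n%:Z) * (p%:Z - 1) = (s - m - n * p.-1)%N%:Z.
  move=> nc; have -> : (s - m - n * p.-1 = b' - m + (c' - n) * p.-1)%N.
    rewrite mulnBl /s; have := leq_mul nc (leqnn p.-1).
    by move: (c' * _)%N (n * _)%N => x y; lia.
  rewrite PoszD PoszM -subzn // -subzn // -subzn // PoszD PoszM.
  by rewrite -subn1 -subzn //; ring.
have idxE (n : nat) : (n <= c')%N ->
    (binz (r - l) (b%:Z - m%:Z + (c%:Z - n%:Z) * (p%:Z - 1)))%:~R
    = 'C(s - l, s - m - n * p.-1)%:R :> F.
  by move=> nc; rewrite idx // /binz -pmulrn binE // -subnDA leq_subr.
have mc1 : (m.+1 <= c'.+1)%N by lia.
rewrite (big_cat_nat _ mc1) //= /alpha intrD addrC.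
congr (_ + _); last first.
  case: (leqP i m) => im1.
    have ni : (m.+1 - i <= c')%N by lia.
    have nin : (m.+1 - i)%N \in index_iota 1 m.+1.
      by rewrite mem_index_iota subn_gt0 ltnS im1 ltn_subrL i0.
    rewrite (bigD1_seq _ nin (iota_uniq _ _)) /=.
    rewrite Pn ?eqxx ?mulr1; last by lia.
    rewrite big1_seq ?addr0 => [|n]; last first.
      rewrite mem_index_iota => /andP[ni' /andP[n0 nm]].
      by rewrite Pn // (negPf ni') mulr0.
    rewrite -idxE //; congr (binz _ (_ + _ * _))%:~R.
    by rewrite -subzn //; lia.
  rewrite big1_seq // => n; rewrite mem_index_iota => /andP[_ /andP[n0 nm]].
  by rewrite Pn // (_ : _ == _ = false) ?mulr0 //; apply/eqP; lia.
rewrite /alpha1 eE rmorphM rmorph_sum /= rmorphXn rmorphN1 mulr_sumr.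
rewrite -(add1n m) big_addn (_ : c'.+1 - m = (c - m - e).+1)%N; last by lia.
apply: eq_big_nat => a /andP[a0 ac].
rewrite rmorphM /= mulrCA (beta_lagrange ilim sP Pn a0) addnC.
congr (_ * _); rewrite -idxE; last by lia.
by congr (binz _ (_ + _ * _))%:~R; rewrite PoszD; ring.
Qed.

(** * Lifting to the p-adic integers, and the theorem *)

Lemma padic_lift_solution (p k l : nat) (A : 'M[int]_(k, l)) (v : 'cV[int]_k)
    (X : 'cV['F_p]_l) : prime p ->
  map_mx intr A *m X = map_mx intr v ->
  exists Y : 'cV[padic p]_l, padic_eqmod (map_mx intr A *m Y) (map_mx intr v).
Proof.
move=> p_pr AX.
(* Lifting X to integers first lets A Y - v be divided by p in the integers. *)
pose Y : 'cV[int]_l := \col_j (val (X j 0))%:Z.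
have XY : X = map_mx intr Y.
  by apply/colP => j; rewrite !mxE -pmulrn natr_Zp.
pose w i : int := (A *m Y - v) i 0.
have dvdw i : (p %| w i)%Z.
  have /colP/(_ i) : map_mx intr (A *m Y - v) = 0 :> 'cV['F_p]_k.
    by rewrite map_mxB map_mxM -XY AX subrr.
  by rewrite mxE [RHS]mxE => /eqP; rewrite -(dvdz_pcharf (pchar_Fp p_pr)).
exists (map_mx intr Y), (map_mx intr (\col_i (w i %/ p)%Z)).
rewrite -map_mxM -map_mxB; apply/colP => i.
rewrite [LHS]mxE -/(w i) [RHS]mxE [in RHS]mxE [in RHS]mxE /=.
by rewrite -{1}(divzK (dvdw i)) intrM mulrC.
Qed.

Theorem theorem8p1 (p b c t d m s r : nat)
  (p_prime : prime p) (p_ge5 : (5 <= p)%N)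
  (hb : (2 <= b <= p)%N) (hc : (1 <= c <= p - 1)%N)
  (ht : (2 <= t)%N) (hd : (1 <= d)%N) (hpd : ~~ (p %| d)%N)
  (hs : s = (b + c * (p - 1))%N)
  (hr : r = (s + p ^ t * (p - 1) * d)%N)
  (hm : 1 <= m%:Z <= c%:Z - 1 - (eps p b c)%:Z)
  (hcases :
     [\/ (c%:Z + 1 <= b%:Z) /\ (1 <= m%:Z <= b%:Z - c%:Z),
         [/\ c%:Z <= b%:Z,
             (1 <= m%:Z) && (2 * m%:Z <= b%:Z - 1)
           & b%:Z - c%:Z + 1 <= m%:Z <= c%:Z - 1 - (eps p b c)%:Z],
         [/\ 2 <= b%:Z <= c%:Z - 1,
             (1 <= m%:Z) && (2 * m%:Z <= b%:Z - 1) \/ b%:Z <= m%:Z <= c%:Z - 2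
           & 1 <= m%:Z <= p%:Z + b%:Z - c%:Z]
       | [/\ 2 <= b%:Z <= 2 * c%:Z - 3 - p%:Z,
             (p%:Z + b%:Z - c%:Z + 1 <= m%:Z) && (2 * m%:Z <= p%:Z + b%:Z - 2)
           & p%:Z + b%:Z - c%:Z + 1 <= m%:Z <= c%:Z - 3]]) :
  forall i : nat, (1 <= i <= m)%N ->
    exists X : 'cV[padic p]_m.+1,
      padic_eqmod (map_mx intr (alpha_mx p b c m r) *m X)
                  (\col_(k < m.+1) (k.+1 == i)%:R).
Proof.
move=> i im.
have charFp := pchar_Fp p_prime.
have m1 : (1 <= m)%N by lia.
have mc : (m < c)%N by lia.
have [e [eE m2b bmp ec mce]] : exists e, [/\ eps1 p b m = e,
    (2 * m < b + e * p.-1)%N, (b + e * p.-1 - m < p)%N, (e <= c)%N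
    & (m < c - e)%N].
  have [m2b|bm2] := ltnP (2 * m) b.
    exists 0%N; rewrite /eps1 ifT; last by lia.
    by split => //; lia.
  (* Only case (4) and the range [b, c-2] of case (3) allow b <= 2m; in the latter, add m <= c - 2
     and m <= p + b - c. *)
  have [bm m2p mc2] : [/\ (b <= m)%N, (2 * m <= p + b - 2)%N & (m <= c - 2)%N].
    by case: hcases => [[]|[]|[? []]|[]]; split; lia.
  exists 1%N; rewrite /eps1 ifF; last by lia.
  rewrite ifT; last by lia.
  by split; lia.
have sE : s = (b + e * p.-1 + (c - e) * p.-1)%N.
  by rewrite hs -addnA -mulnDl subnKC // subn1.
have binE l k : (l <= m)%N -> (k <= s)%N ->
    'C(r - l, k)%:R = 'C(s - l, k)%:R :> 'F_p.
  move=> lm ks; have ls : (l <= s)%N by rewrite hs; nia.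
  have -> : (r - l = s - l + p ^ t * ((p - 1) * d))%N.
    by rewrite hr mulnA addnBAC.
  (* Here k <= s <= p + (p-1)^2 < p^2 <= p^t. *)
  apply: (natr_binD_pexp charFp); apply: (@leq_trans (p ^ 2)%N).
    by apply: leq_ltn_trans ks _; rewrite hs expnS expn1; nia.
  by rewrite leq_exp2l //; lia.
have cep : (c - e < p)%N by lia.
have n0m : (0 < m.+1 - i <= m)%N by lia.
have [X XE] := node_evaluation_moments charFp m2b bmp mce cep n0m.
have delta_col : \col_(k < m.+1) (k.+1 == i)%:R =
    map_mx intr (\col_(k < m.+1) (k.+1 == i)%:R) :> 'cV[padic p]_m.+1.
  by apply/colP => k; rewrite !mxE rmorph_nat.
rewrite delta_col; apply: (padic_lift_solution (X := X)) => //.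
apply/colP => k; rewrite !mxE rmorph_nat.
have ltk := ltn_ord k.
have inj_nodes : forall j j', (j < m.+1)%N -> (j' < m.+1)%N ->
    j%:R = j'%:R :> 'F_p -> j = j'.
  by move=> j j' jm jm'; apply: (natf_inj_lt charFp); lia.
have km : (m - k < m.+1)%N by lia.
have [P sP Pn] := lagrange_exists inj_nodes km.
have kpos : (0 < k.+1 <= m.+1)%N by [].
have Pn' n : (n <= m)%N -> P.[n%:R] = (n == m.+1 - k.+1)%N%:R.
  by move=> nm; rewrite Pn // subSS.
(* Entry k of the product is P(m + 1 - i), which is 1 exactly when m + 1 - i = m - k, that is k + 1
   = i. *)
transitivity P.[(m.+1 - i)%:R]; last first.
  by rewrite Pn; [congr (nat_of_bool _)%:R; apply/eqP/eqP; lia | lia].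
rewrite -XE //; apply: eq_bigr => l _; rewrite !mxE mulrC; congr (_ * _).
have lm : (l <= m)%N by rewrite -ltnS.
rewrite (@alpha_moment _ p b c m r k.+1 l e P) //; try lia.
by move=> k' k's; rewrite binE // -?sE // sE.
Qed.
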